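(* Let $n \ge 2$ and let $P$ be a symmetric alcoved polytope of type $B_n$ or $C_n$. Then $P$ has a generating set consisting of $2n$ vertices of $P$.
   Context: For a root system $\Phi$ in a real inner product space $V$, an alcoved polytope of type $t$ is a bounded set of the form $\bigcap_{a \in \Psi}\{x \in V : \langle a, x\rangle \le c_a\}$, where $\Psi$ is a subset of a root system $\Phi$ of type $t$ in $V$ and $c_a \in \mathbb{R}$. It is symmetric if it is invariant under the Weyl group of $\Phi$ (the group generated by the reflections in the hyperplanes orthogonal to the roots). A subset $\Sigma \subseteq V$ is a generating set of $P$ if $P$ is the smallest alcoved polytope (for $\Phi$) in $V$ containing $\Sigma$. (The number $2n$ is the Coxeter number of $B_n$ and $C_n$.) *)

(* Defs.v *)
From HB Require Import structures.
From mathcomp Require Import all_boot all_order all_algebra.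
From mathcomp Require Import sesquilinear.
From mathcomp Require Import boolp classical_sets cardinality reals.

Set Implicit Arguments.
Unset Strict Implicit.
Unset Printing Implicit Defensive.

Import Order.TTheory GRing.Theory Num.Theory.

Local Open Scope ring_scope.
Local Open Scope classical_set_scope.

Section Roots.
Variables (R : realType) (V : vectType R) (B : V -> V -> R).

Definition cartan (a b : V) : R := 2 * B a b / B b b.

Definition reflection (a x : V) : V := x - cartan x a *: a.

(* Reduced crystallographic root system spanning V. *)
Record is_root_system (Phi : set V) : Prop := IsRootSystem {
  root_finite : finite_set Phi;
  root_span : (<<finmap.enum_fset (fset_set Phi)>> = fullv)%VS;
  root_neq0 : ~ Phi 0;
  root_reduced : forall (a : V) (k : R),
    Phi a -> Phi (k *: a) -> k = 1 \/ k = - 1;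
  root_reflection : forall a b : V, Phi a -> Phi b -> Phi (reflection a b);
  root_integral : forall a b : V, Phi a -> Phi b -> cartan a b \is a Num.int
}.

(* Reflections are involutions, so closure under composition already yields the
   generated group. *)
Inductive weyl_group (Phi : set V) : (V -> V) -> Prop :=
| weyl_id : weyl_group Phi id
| weyl_reflection a : Phi a -> weyl_group Phi (reflection a)
| weyl_comp w1 w2 :
    weyl_group Phi w1 -> weyl_group Phi w2 -> weyl_group Phi (w1 \o w2).

Definition bounded_for (P : set V) : Prop :=
  exists M : R, forall x, P x -> Num.sqrt (B x x) <= M.

Definition alcoved_polytope (Phi P : set V) : Prop :=
  bounded_for P /\
  exists (Psi : set V) (c : V -> R),
    Psi `<=` Phi /\ P = [set x | forall a, Psi a -> B a x <= c a].

Definition weyl_symmetric (Phi P : set V) : Prop :=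
  forall w, weyl_group Phi w -> w @` P = P.

Definition generating_set (Phi P S : set V) : Prop :=
  [/\ alcoved_polytope Phi P, S `<=` P &
      forall Q, alcoved_polytope Phi Q -> S `<=` Q -> P `<=` Q].

(* A vertex is a zero-dimensional face: the unique maximizer over P of some
   linear functional. *)
Definition vertex (P : set V) (x : V) : Prop :=
  P x /\ exists u : V, forall y, P y -> y <> x -> B u y < B u x.

End Roots.

Section Types.
Variables (R : realType) (n : nat).

Definition std_dot (u v : 'rV[R]_n) : R := \sum_(i < n) u 0 i * v 0 i.

Definition D_roots : set 'rV[R]_n :=
  [set v | exists (i j : 'I_n) (s t : bool),
    i != j /\ v = (-1) ^+ s *: 'e_i + (-1) ^+ t *: 'e_j].

Definition std_B : set 'rV[R]_n :=
  [set v | exists (i : 'I_n) (s : bool), v = (-1) ^+ s *: 'e_i]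
  `|` D_roots.

Definition std_C : set 'rV[R]_n :=
  [set v | exists (i : 'I_n) (s : bool), v = (-1) ^+ s *: (2 *: 'e_i)]
  `|` D_roots.

(* Isomorphism of root systems: a linear bijection carrying one onto the other
   and preserving the Cartan integers (it need not be an isometry). *)
Definition root_system_iso (V : vectType R) (B : V -> V -> R)
    (Phi0 : set 'rV[R]_n) (Phi : set V) : Prop :=
  exists f : {linear 'rV[R]_n -> V},
    [/\ bijective f, f @` Phi0 = Phi &
        forall a b, Phi0 a -> Phi0 b ->
          cartan B (f a) (f b) = cartan std_dot a b].

Definition type_B (V : vectType R) (B : V -> V -> R) (Phi : set V) : Prop :=
  is_root_system B Phi /\ root_system_iso B std_B Phi.

Definition type_C (V : vectType R) (B : V -> V -> R) (Phi : set V) : Prop :=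
  is_root_system B Phi /\ root_system_iso B std_C Phi.

End Types.

(* Main.v *)
Require Import Defs.
From HB Require Import structures.
From mathcomp Require Import all_boot all_order all_algebra.
From mathcomp Require Import sesquilinear.
From mathcomp Require Import boolp classical_sets cardinality reals.
From mathcomp Require Import fingroup.perm ring lra.

Set Implicit Arguments.
Unset Strict Implicit.
Unset Printing Implicit Defensive.

Import Order.TTheory GRing.Theory Num.Theory.

Local Open Scope ring_scope.
Local Open Scope classical_set_scope.

(* In coordinates the form is a multiple of the standard one, and a symmetric
   alcoved polytope of type B_n or C_n is
   [{x | |x_i| <= a, |x_i| + |x_j| <= b for i != j}], where [a] and [b] are the
   values of the support function on the roots; symmetry forces
   [a <= b <= 2 a]. The signed permutations of [(a, b - a, ..., b - a)] are
   vertices, and a point with large entry at [i] and signs [s] is extremal for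
   the root [s_i e_i] and for all roots [s_i e_i + s_j e_j]. Taking for each [i]
   the two points with sign vectors [+-(-1, ..., -1, 1, ..., 1)], the entry [i]
   being the first one after the sign change, every root attains its maximum. *)

(** * Standard dot product and reflections in coordinates *)

Section StandardDot.
Variables (R : realType) (n : nat).
Implicit Types (x y : 'rV[R]_n) (i j k : 'I_n).

Lemma std_dotC x y : std_dot x y = std_dot y x.
Proof. by apply: eq_bigr => i _; rewrite mulrC. Qed.

Lemma std_dotDl x y z : std_dot (x + y) z = std_dot x z + std_dot y z.
Proof. by rewrite -big_split; apply: eq_bigr => i _; rewrite mxE mulrDl. Qed.

Lemma std_dotZl (c : R) x y : std_dot (c *: x) y = c * std_dot x y.
Proof. by rewrite big_distrr; apply: eq_bigr => i _; rewrite mxE /= mulrA. Qed.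

Lemma std_dot_suml (I : Type) (r : seq I) (Q : pred I) (F : I -> 'rV[R]_n) y :
  std_dot (\sum_(i <- r | Q i) F i) y = \sum_(i <- r | Q i) std_dot (F i) y.
Proof.
rewrite /std_dot exchange_big; apply: eq_bigr => i _ /=.
by rewrite summxE mulr_suml.
Qed.

Lemma std_dot_el i y : std_dot 'e_i y = y 0 i.
Proof.
rewrite /std_dot (bigD1 i) //= big1 ?addr0 ?mxE ?eqxx ?mul1r // => j ji.
by rewrite !mxE /= (negbTE ji) mul0r.
Qed.

(** The scale [c] cancels, so the short roots of B_n and the long roots of C_n give the same sign
    change. *)
Lemma reflection_axis (c : R) i j x : c != 0 ->
  reflection (@std_dot R n) (c *: 'e_i) x 0 j = (-1) ^+ (j == i) * x 0 j.
Proof.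
move=> c0; rewrite /reflection /cartan [std_dot x _]std_dotC !std_dotZl.
rewrite !std_dot_el !mxE /= eqxx.
have [->|ji] := eqVneq j i; last by rewrite !mulr0 subr0 mul1r.
by rewrite expr1 /= !mulr1; field.
Qed.

Lemma reflection_diff i k j x : i != k ->
  reflection (@std_dot R n) ('e_i - 'e_k) x 0 j = x 0 (tperm i k j).
Proof.
move=> ik; rewrite /reflection /cartan [std_dot x _]std_dotC -(scaleN1r 'e_k).
rewrite !std_dotDl !std_dotZl !std_dot_el !mxE /= !eqxx (eq_sym k i) (negbTE ik) /=.
rewrite (_ : 1 + -1 * 0 + -1 * (0 + -1 * 1) = 2 :> R); last by lra.
case: tpermP => [->|->|/eqP/negPf-> /eqP/negPf->] /=.
- by rewrite eqxx (negbTE ik) /=; lra.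
- by rewrite eqxx (eq_sym k i) (negbTE ik) /=; lra.
- by rewrite mulr0 addr0 mulr0 subr0.
Qed.

End StandardDot.

Section StandardPolytope.
Variables (R : realType) (n : nat) (c : R).
Hypothesis c_gt0 : 0 < c.
Implicit Types (x y : 'rV[R]_n) (i j k : 'I_n) (s t u : bool).

Local Notation dotn := (@std_dot R n).

(* [c = 1] gives B_n and [c = 2] gives C_n. *)
Definition std_BC : set 'rV[R]_n :=
  [set v | exists (i : 'I_n) (s : bool), v = (-1) ^+ s *: (c *: 'e_i)]
  `|` @D_roots R n.

Lemma std_BC_axis i : std_BC (c *: 'e_i).
Proof. by left; exists i, false; rewrite expr0 scale1r. Qed.

Lemma std_BC_pair i j s t : i != j ->
  std_BC ((-1) ^+ s *: 'e_i + (-1) ^+ t *: 'e_j).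
Proof. by move=> ij; right; exists i, j, s, t. Qed.

(** * Signed permutations and the support function of a symmetric set *)

Section Symmetric.
Variable P : set 'rV[R]_n.
Hypothesis P_refl : forall a x, std_BC a -> P x -> P (reflection dotn a x).

Lemma symmetric_flip i s x : P x ->
  exists2 y, P y & forall j, y 0 j = (-1) ^+ ((j == i) && s) * x 0 j.
Proof.
move=> Px; case: s.
  exists (reflection dotn (c *: 'e_i) x); first exact/P_refl/Px/std_BC_axis.
  by move=> j; rewrite andbT reflection_axis // gt_eqF.
by exists x => // j; rewrite andbF mul1r.
Qed.

Lemma symmetric_swap i k x : P x ->
  exists2 y, P y & forall j, y 0 j = x 0 (tperm i k j).
Proof.
move=> Px; have [->|ik] := eqVneq i k.
  by exists x => // j; rewrite tperm1 perm1.
exists (reflection dotn ('e_i - 'e_k) x); last by move=> j; rewrite reflection_diff.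
apply: P_refl Px; have := std_BC_pair false true ik.
by rewrite expr0 scale1r expr1 scaleN1r.
Qed.

Lemma symmetric_move1 i k s x : P x ->
  exists2 y, P y & y 0 k = (-1) ^+ s * x 0 i.
Proof.
move=> /(symmetric_swap i k)[y Py yE].
have [z Pz zE] := symmetric_flip k s Py.
by exists z => //; rewrite zE eqxx yE tpermR.
Qed.

Lemma symmetric_move2 i j k l s t x : i != j -> k != l -> P x ->
  exists2 y, P y & y 0 k = (-1) ^+ s * x 0 i /\ y 0 l = (-1) ^+ t * x 0 j.
Proof.
move=> ij kl /(symmetric_swap i k)[y Py yE].
(* [m] is where the first swap puts the entry [x 0 j]. Since [m != k], swapping [m] with [l] leaves
   the entry at [k] alone. *)
set m := tperm i k j.
have km : k != m by rewrite -(tpermL i k) (inj_eq perm_inj).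
have [z Pz zE] := symmetric_swap m l Py.
have [w Pw wE] := symmetric_flip k s Pz.
have [v Pv vE] := symmetric_flip l t Pw.
exists v => //; rewrite !vE !wE !zE !eqxx (negbTE kl) eq_sym (negbTE kl) /= !mul1r.
have -> : tperm m l k = k by rewrite tpermD // eq_sym.
by rewrite tpermR !yE tpermR tpermK.
Qed.

Hypotheses (P_bounded : bounded_for dotn P) (P_neq0 : P !=set0).

Lemma bounded_coord : exists M : R, forall x i, P x -> x 0 i <= M.
Proof.
have [M MP] := P_bounded; exists M => x i /MP; apply: le_trans.
rewrite (le_trans (ler_norm _)) // -sqrtr_sqr ler_wsqrtr //.
rewrite /std_dot (bigD1 i) //= -expr2 lerDl sumr_ge0 // => j _.
by rewrite -expr2 sqr_ge0.
Qed.

(** Signed permutations carry any signed coordinate to coordinate [i], so one supremum is the least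
    upper bound for all of them. Leastness is stated per signed position so that it can be compared
    with the constant of a single defining inequality. *)
Lemma support_axis i : exists a : R,
  (forall x j s, P x -> (-1) ^+ s * x 0 j <= a) /\
  (forall j s (M : R), (forall x, P x -> (-1) ^+ s * x 0 j <= M) -> a <= M).
Proof.
have [M MP] := bounded_coord; have [x0 Px0] := P_neq0.
pose A : set R := [set x 0 i | x in P].
have A0 : A !=set0 by exists (x0 0 i), x0.
exists (sup A); split=> [x j s Px|j s K KP].
  apply: ub_le_sup; first by exists M => _ [y Py <-]; exact: MP.
  by have [y Py yE] := symmetric_move1 j i s Px; exists y.
apply: ge_sup => // _ [x Px <-].
have [y Py yE] := symmetric_move1 i j s Px.
by have := KP _ Py; rewrite yE signrMK.
Qed.

(** Same argument for ordered pairs of distinct coordinates, on which signed permutations act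
    transitively. *)
Lemma support_pair i k : i != k -> exists b : R,
  (forall x j l s t, j != l -> P x ->
     (-1) ^+ s * x 0 j + (-1) ^+ t * x 0 l <= b) /\
  (forall j l s t (M : R), j != l ->
     (forall x, P x -> (-1) ^+ s * x 0 j + (-1) ^+ t * x 0 l <= M) -> b <= M).
Proof.
move=> ik; have [M MP] := bounded_coord; have [x0 Px0] := P_neq0.
pose A : set R := [set x 0 i + x 0 k | x in P].
have A0 : A !=set0 by exists (x0 0 i + x0 0 k), x0.
exists (sup A); split=> [x j l s t jl Px|j l s t K jl KP].
  apply: ub_le_sup.
    by exists (M + M) => _ [y Py <-]; apply: lerD; exact: MP.
  have [y Py [yi yk]] := symmetric_move2 s t jl ik Px.
  by exists y => //; rewrite yi yk.
apply: ge_sup => // _ [x Px <-].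
have [y Py [yj yl]] := symmetric_move2 s t ik jl Px.
by have := KP _ Py; rewrite yj yl !signrMK.
Qed.

End Symmetric.

(* The points of the orbit of [(a, b - a, ..., b - a)] whose large entry is at
   [i] with sign [s]. The signs of the other entries are such that, for each
   pair of positions [i < j], the four points with large entry at [i] or [j]
   realize all four sign patterns at [(i, j)]. *)
Definition gen_point (a b : R) (i : 'I_n) (s : bool) : 'rV[R]_n :=
  \row_j ((-1) ^+ s * (if j == i then a else (-1) ^+ (j < i)%N * (b - a))).

(** * Extremality of the generating points *)

Section GenPoint.
Variables a b : R.
Hypotheses (ab : a <= b) (ba : b <= a + a).

(** The hypotheses amount to [0 <= b - a <= a], which bounds every entry by [a] in absolute
    value. *)
Lemma gen_point_axis_le i j s t : (-1) ^+ t * gen_point a b i s 0 j <= a.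
Proof.
move: ab ba => ? ?; rewrite mxE; case: eqP => _; case: (j < i)%N; case: s; case: t;
  rewrite ?expr0 ?expr1 /=; lra.
Qed.

(** At most one of two distinct entries is large, so the absolute values add up to [a + (b - a) = b]
    or to [2 (b - a) <= b]. *)
Lemma gen_point_pair_le i j k s t u : j != k ->
  (-1) ^+ t * gen_point a b i s 0 j + (-1) ^+ u * gen_point a b i s 0 k <= b.
Proof.
move: ab ba => ? ? jk; rewrite !mxE.
have [ji|_] := eqVneq j i; have [ki|_] := eqVneq k i.
- by rewrite ji ki eqxx in jk.
- by case: (k < i)%N; case: s; case: t; case: u; rewrite ?expr0 ?expr1 /=; lra.
- by case: (j < i)%N; case: s; case: t; case: u; rewrite ?expr0 ?expr1 /=; lra.
- by case: (j < i)%N; case: (k < i)%N; case: s; case: t; case: u;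
    rewrite ?expr0 ?expr1 /=; lra.
Qed.

Lemma gen_point_axis i s : (-1) ^+ s * gen_point a b i s 0 i = a.
Proof. by rewrite mxE eqxx signrMK. Qed.

Lemma gen_point_off i j s : j != i ->
  gen_point a b i s 0 j = (-1) ^+ (s (+) (j < i)%N) * (b - a).
Proof. by move=> ji; rewrite mxE (negbTE ji) mulrA signr_addb. Qed.

(** For [i < j], the point with large entry at [i] has the same sign at [j], while the point with
    large entry at [j] has the opposite sign at [i]. The first serves [s = t], the second
    [s != t]. *)
Lemma gen_point_pair i j s t : i != j -> exists k u,
  (-1) ^+ s * gen_point a b k u 0 i + (-1) ^+ t * gen_point a b k u 0 j = b.
Proof.
wlog ij : i j s t / (i < j)%N.
  move=> H ij; have [lt_ij|lt_ji|eq_ij] := ltngtP i j; first exact: H.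
    have [|k [u E]] := H j i t s lt_ji; first by rewrite eq_sym.
    by exists k, u; rewrite addrC.
  by move: ij; rewrite (val_inj eq_ij) eqxx.
move=> nij; have nji : j != i by rewrite eq_sym.
have [<-|st] := eqVneq s t.
  exists i, s; rewrite gen_point_axis gen_point_off // ltnNge ltnW //.
  by rewrite addbF signrMK addrC subrK.
exists j, t; rewrite gen_point_axis gen_point_off // ij addbT.
by case: s t st => -[] // _; rewrite ?expr0 ?expr1 /=; lra.
Qed.

(** If [i < j] and the points agree, their entries at [j] and [i] give [b - a = e a] and
    [a = - e (b - a)] for one sign [e], hence [a = - a]. This covers [b = 2 a], where all entries
    have equal size. *)
Lemma gen_point_inj i j s t : a != 0 ->
  gen_point a b i s = gen_point a b j t -> (i, s) = (j, t).
Proof.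
move=> a0; wlog ij : i j s t / (i <= j)%N.
  by move=> H; case/orP: (leq_total i j) => ij E; [|apply/esym]; apply: H.
move=> E; have := congr1 (fun v : 'rV[R]_n => v 0 i) E.
have := congr1 (fun v : 'rV[R]_n => v 0 j) E.
rewrite !mxE !eqxx [j == i]eq_sym; have [<- _|nij] := eqVneq i j.
  by move/(mulIf a0)/signr_inj->.
have lt_ij : (i < j)%N by rewrite ltn_neqAle ij andbT.
rewrite lt_ij ltnNge ij /= => E1 E2; case/eqP: a0; move: E1 E2.
by case: s {E}; case: t; rewrite ?expr0 ?expr1 /=; lra.
Qed.

(* The functional is the sum of the roots that are tight at the point. *)
Lemma gen_point_vertex (P : set 'rV[R]_n) i s :
  (forall x j t, P x -> (-1) ^+ t * x 0 j <= a) ->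
  (forall x j k t u, j != k -> P x ->
     (-1) ^+ t * x 0 j + (-1) ^+ u * x 0 k <= b) ->
  P (gen_point a b i s) -> vertex dotn P (gen_point a b i s).
Proof.
move=> Pa Pb Pv; split=> //.
(* [r j] is the sign attached to [b - a] in the entry at [j]. *)
pose r j : bool := s (+) (j < i)%N.
exists ((-1) ^+ s *: 'e_i
        + \sum_(j | j != i) ((-1) ^+ s *: 'e_i + (-1) ^+ (r j) *: 'e_j)).
have uE x : dotn ((-1) ^+ s *: 'e_i
     + \sum_(j | j != i) ((-1) ^+ s *: 'e_i + (-1) ^+ (r j) *: 'e_j)) x =
   (-1) ^+ s * x 0 i + \sum_(j | j != i) ((-1) ^+ s * x 0 i + (-1) ^+ (r j) * x 0 j).
  rewrite std_dotDl std_dotZl std_dot_el std_dot_suml; congr (_ + _).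
  by apply: eq_bigr => j _; rewrite std_dotDl !std_dotZl !std_dot_el.
move=> y Py yv; rewrite !uE gen_point_axis.
have vE j : j != i -> a + (-1) ^+ (r j) * gen_point a b i s 0 j = b.
  by move=> ji; rewrite gen_point_off // signrMK addrC subrK.
have le_b j : j != i -> (-1) ^+ s * y 0 i + (-1) ^+ (r j) * y 0 j <=
    a + (-1) ^+ (r j) * gen_point a b i s 0 j.
  by move=> ji; rewrite vE //; apply: Pb; rewrite // eq_sym.
(* Either [y] loses on the axis root, or it agrees with the point at [i] and differs at some other
   [j], where the pair root is then strictly smaller. *)
have := Pa y i s Py; rewrite le_eqVlt => /orP[/eqP yi|lt_a]; last first.
  by apply: ltr_leD => //; apply: ler_sum.
have [j ji yj] : exists2 j, j != i & y 0 j != gen_point a b i s 0 j.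
  apply: contrapT => H; apply: yv; apply/rowP => j.
  have [->|ji] := eqVneq j i.
    by apply: (@mulfI _ ((-1) ^+ s)); rewrite ?signr_eq0 // gen_point_axis.
  by apply/eqP; apply: contrapT => /negP yj; apply: H; exists j.
apply: ler_ltD; first by rewrite yi.
rewrite !(bigD1 (P := fun j => j != i) j) //=; apply: ltr_leD.
  rewrite lt_neqAle le_b // andbT yi; apply: contra yj => /eqP/addrI/mulfI E.
  by apply/eqP/E; rewrite signr_eq0.
by apply: ler_sum => k /andP[ki _]; apply: le_b.
Qed.

End GenPoint.

(** The index set ['I_n * bool] records position and sign of the large entry, which accounts for the
    number [2n]. *)
Lemma std_symmetric_generators (P : set 'rV[R]_n) : (2 <= n)%N ->
  alcoved_polytope dotn std_BC P -> P !=set0 ->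
  (forall a x, std_BC a -> P x -> P (reflection dotn a x)) ->
  exists v : 'I_n * bool -> 'rV[R]_n,
    [/\ P <> [set 0] -> injective v,
        forall p, vertex dotn P (v p) &
        generating_set dotn std_BC P (range v)].
Proof.
move=> n2 alcP P0 P_refl; have [P_bd [Psi [d [PsiPhi PE]]]] := alcP.
pose i0 : 'I_n := Ordinal (ltnW n2); pose i1 : 'I_n := Ordinal n2.
have i01 : i0 != i1 by [].
have [a [Pa a_min]] := support_axis P_refl P_bd P0 i0.
have [b [Pb b_min]] := support_pair P_refl P_bd P0 i01.
(* A coordinate is the average of its sum and its difference with another coordinate. *)
have ab : a <= b.
  apply: (a_min i0 false) => x Px; rewrite expr0 mul1r.
  have := Pb x _ _ false false i01 Px; have := Pb x _ _ false true i01 Px.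
  by rewrite expr0 expr1; lra.
have ba : b <= a + a.
  by apply: (b_min i0 i1 false false) => // x Px; apply: lerD; apply: Pa.
(* The constants [d] need not be tight, but each bounds its root on [P], hence dominates the support
   value by leastness of [a] and [b]. *)
have Pv i s : P (gen_point a b i s).
  rewrite PE => e Psie /=; case: (PsiPhi _ Psie) => [[j [t eE]]|[j [k [t [u [jk eE]]]]]].
    rewrite eE !std_dotZl std_dot_el mulrCA mulrC -ler_pdivlMr //.
    apply: le_trans (gen_point_axis_le ab ba i j s t) _.
    apply: (a_min j t) => x Px; rewrite ler_pdivlMr // mulrC mulrCA.
    by move: Px; rewrite PE => /(_ _ Psie); rewrite eE !std_dotZl std_dot_el.
  rewrite eE std_dotDl !std_dotZl !std_dot_el.
  apply: le_trans (gen_point_pair_le ab ba i s t u jk) _.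
  apply: (b_min j k t u) => // x; rewrite PE => /(_ _ Psie).
  by rewrite eE std_dotDl !std_dotZl !std_dot_el.
exists (fun p => gen_point a b p.1 p.2); split.
- move=> Pn0 [i s] [j t] /= /gen_point_inj; apply.
  apply/eqP => a0; have P0x x : P x -> x = 0.
    move=> Px; apply/rowP => k; rewrite mxE; apply/eqP; rewrite eq_le.
    have := Pa x k false Px; have := Pa x k true Px; rewrite a0 expr0 expr1.
    by move=> ? ?; apply/andP; split; lra.
  apply: Pn0; apply/seteqP; split=> x /=; first exact: P0x.
  by move=> ->; have [y Py] := P0; rewrite -(P0x y Py).
- by move=> [i s]; apply: gen_point_vertex.
- split=> // [_ [[i s] _ <-]|Q [_ [Psi' [d' [Psi'Phi ->]]]] vQ x Px e Psie] //.
  (* Some generating point attains the maximum of the root [e] over [P], so the constant [d' e] of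
     [Q] is at least that maximum. *)
  have {}vQ i s : dotn e (gen_point a b i s) <= d' e.
    by apply: (vQ _ _ e Psie); exists (i, s).
  case: (Psi'Phi _ Psie) => [[j [t eE]]|[j [k [t [u [jk eE]]]]]].
    apply: le_trans (vQ j t); rewrite eE !std_dotZl !std_dot_el mulrCA [leRHS]mulrCA.
    by rewrite ler_pM2l // gen_point_axis; apply: Pa.
  have [l [w E]] := gen_point_pair a b t u jk.
  apply: le_trans (vQ l w); rewrite eE !std_dotDl !std_dotZl !std_dot_el E.
  exact: Pb.
Qed.

End StandardPolytope.

(** * Transport from coordinates to an arbitrary Euclidean space *)

Section Transport.
Variables (R : realType) (n : nat) (V : vectType R) (dot : {dot V for (@idfun R)}).
Implicit Types (x y : 'rV[R]_n) (i j : 'I_n).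

Local Notation dotn := (@std_dot R n).

Lemma cartan_eq0 (u v : V) : v != 0 -> cartan dot u v = 0 -> dot u v = 0.
Proof.
move=> v0 /eqP; have vv : dot v v != 0 by rewrite gt_eqF // neq0_dnorm_gt0.
by rewrite /cartan !mulf_eq0 invr_eq0 (negbTE vv) orbF pnatr_eq0 /= => /eqP.
Qed.

(* The roots [c *: 'e_i] are orthogonal, and ['e_i + 'e_j] is orthogonal to
   ['e_i - 'e_j], so the images of the ['e_i] are orthogonal of equal length. *)
Lemma root_iso_similarity (c : R) (f : {linear 'rV[R]_n -> V}) :
  (2 <= n)%N -> 0 < c -> injective f ->
  (forall a b, std_BC c a -> std_BC c b ->
     cartan dot (f a) (f b) = cartan dotn a b) ->
  exists2 k : R, 0 < k & forall x y, dot (f x) (f y) = k * dotn x y.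
Proof.
move=> n2 c0 f_inj f_cartan.
have f_neq0 x : x != 0 -> f x != 0 by rewrite -(inj_eq f_inj) raddf0.
have e_neq0 i : 'e_i != 0 :> 'rV[R]_n.
  by apply/eqP => /rowP/(_ i)/eqP; rewrite !mxE !eqxx oner_eq0.
(* A Cartan number vanishes exactly when its roots are orthogonal, so [f] preserves orthogonality of
   roots. *)
have f_orth a b : std_BC c a -> std_BC c b -> b != 0 -> dotn a b = 0 ->
    dot (f a) (f b) = 0.
  move=> ca cb b0 ab; apply: cartan_eq0; first exact: f_neq0.
  by rewrite f_cartan // /cartan ab mulr0 mul0r.
have dotC u v : dot u v = dot v u by rewrite hermC expr0 mul1r.
have fZ (a b : R) x y : dot (f (a *: x)) (f (b *: y)) = a * b * dot (f x) (f y).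
  by rewrite [f (a *: x)]linearZ [f (b *: y)]linearZ /= linearZl_LR linearZr_LR mulrA.
have e_orth i j : i != j -> dot (f 'e_i) (f 'e_j) = 0.
  move=> ij; have := f_orth _ _ (std_BC_axis c i) (std_BC_axis c j).
  rewrite scaler_eq0 gt_eqF //= e_neq0 std_dotZl std_dot_el !mxE eqxx /=.
  rewrite (negbTE ij) !mulr0 => /(_ isT erefl)/eqP.
  by rewrite fZ !mulf_eq0 (gt_eqF c0) /= => /eqP.
have e_norm i j : dot (f 'e_i) (f 'e_i) = dot (f 'e_j) (f 'e_j).
  have [->//|ij] := eqVneq i j.
  have := f_orth _ _ (std_BC_pair c false false ij) (std_BC_pair c false true ij).
  rewrite expr0 expr1 !scale1r scaleN1r std_dotDl !std_dot_el !mxE !eqxx /=.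
  rewrite [j == i]eq_sym (negbTE ij) subr0 add0r subrr => /(_ _ erefl) E.
  have {E}/eqP : dot (f ('e_i + 'e_j)) (f ('e_i - 'e_j)) = 0.
    apply: E; apply/eqP => /rowP/(_ i)/eqP; rewrite !mxE !eqxx (negbTE ij).
    by rewrite subr0 oner_eq0.
  rewrite raddfD raddfB linearDl !linearBr /= (dotC (f 'e_j) (f 'e_i))
    (e_orth _ _ ij).
  by rewrite subr0 sub0r subr_eq0 => /eqP.
pose i0 : 'I_n := Ordinal (ltnW n2).
exists (dot (f 'e_i0) (f 'e_i0)); first exact/neq0_dnorm_gt0/f_neq0.
move=> x y; rewrite {1}[x]row_sum_delta {1}[y]row_sum_delta !(raddf_sum f) /=.
rewrite linear_sumlz /std_dot mulr_sumr; apply: eq_bigr => i _.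
rewrite linear_sumr (bigD1 i) //= big1 ?addr0 => [|j ji].
  by rewrite fZ (e_norm i i0); ring.
by rewrite fZ e_orth 1?eq_sym // !mulr0.
Qed.

Section Similarity.
Variables (f : {linear 'rV[R]_n -> V}) (g : V -> 'rV[R]_n) (k : R).
Hypotheses (fK : cancel f g) (gK : cancel g f) (k_gt0 : 0 < k).
Hypothesis f_dot : forall x y, dot (f x) (f y) = k * dotn x y.

Lemma reflection_similarity a x :
  reflection dot (f a) (f x) = f (reflection dotn a x).
Proof.
have -> : f (reflection dotn a x) = f x - cartan dotn x a *: f a.
  by rewrite [LHS]raddfB; congr (_ - _); exact: linearZZ.
rewrite /reflection /cartan !f_dot.
by rewrite mulrCA -mulf_div divff ?mul1r // gt_eqF.
Qed.

(** Pulling back along [f] divides the norm bound by the square root of [k] and the constants of the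
    inequalities by [k]. *)
Lemma alcoved_similarity (Phi0 : set 'rV[R]_n) (P : set V) :
  alcoved_polytope dot (f @` Phi0) P ->
  alcoved_polytope dotn Phi0 (f @^-1` P).
Proof.
move=> [[M MP] [Psi [d [PsiPhi PE]]]]; split.
  exists (M / Num.sqrt k) => x /MP; rewrite f_dot (sqrtrM _ (ltW k_gt0)).
  by rewrite ler_pdivlMr ?sqrtr_gt0 // mulrC.
exists (f @^-1` Psi), (fun a => d (f a) / k); split.
  by move=> a /PsiPhi[b Phib /(can_inj fK) <-].
rewrite PE; apply/seteqP; split=> x /= H a Psia.
  by rewrite ler_pdivlMr // mulrC -f_dot; apply: H.
rewrite -(gK a) f_dot mulrC -ler_pdivlMr //.
by have := H (g a); rewrite /= gK; apply.
Qed.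

Lemma vertex_similarity (P : set V) x :
  vertex dotn (f @^-1` P) x -> vertex dot P (f x).
Proof.
move=> [Px [u uP]]; split=> //; exists (f u) => y Py yx.
rewrite -(gK y) !f_dot ltr_pM2l //; apply: uP; first by rewrite /= gK.
by move=> E; apply: yx; rewrite -E gK.
Qed.

(** Each competitor [Q] is pulled back to coordinates, where minimality is known. *)
Lemma generating_set_similarity (Phi0 S : set 'rV[R]_n) (P : set V) :
  alcoved_polytope dot (f @` Phi0) P ->
  generating_set dotn Phi0 (f @^-1` P) S ->
  generating_set dot (f @` Phi0) P (f @` S).
Proof.
move=> alcP [_ SP minP]; split=> // [_ [x Sx <-]|Q alcQ SQ y Py]; first exact: SP.
rewrite -(gK y); apply: (minP (f @^-1` Q)); first exact: alcoved_similarity.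
- by move=> x Sx; apply: SQ; exists x.
- by rewrite /= gK.
Qed.

End Similarity.

Lemma symmetric_generators (c : R) (Phi P : set V) :
  (2 <= n)%N -> 0 < c -> root_system_iso dot (@std_BC R n c) Phi ->
  alcoved_polytope dot Phi P -> P !=set0 -> weyl_symmetric dot Phi P ->
  exists v : 'I_n * bool -> V,
    [/\ P <> [set 0] -> injective v,
        forall p, vertex dot P (v p) &
        generating_set dot Phi P (range v)].
Proof.
move=> n2 c0 [f [[g fK gK] <- f_cartan]] alcP [p Pp] symP.
have [k k0 f_dot] := root_iso_similarity n2 c0 (can_inj fK) f_cartan.
have [||a x ca Px|v [v_inj v_vertex v_gen]] :=
    @std_symmetric_generators R n c c0 (f @^-1` P) n2.
- exact: (alcoved_similarity fK gK k0 f_dot).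
- by exists (g p); rewrite /= gK.
- rewrite /= -(reflection_similarity k0 f_dot).
  rewrite -(symP (reflection dot (f a))); first by exists (f x).
  by apply: weyl_reflection; exists a.
exists (f \o v); split.
- move=> Pn0; apply: inj_comp (can_inj fK) (v_inj _) => PE; apply: Pn0.
  apply/seteqP; split=> [x Px|_ ->].
    have : (f @^-1` P) (g x) by rewrite /= gK.
    by rewrite PE /= => gx; rewrite -(gK x) gx raddf0.
  by have : (f @^-1` P) 0 by [rewrite PE|]; rewrite /= raddf0.
- by move=> q; apply: (vertex_similarity gK k0 f_dot).
- have := generating_set_similarity fK gK k0 f_dot alcP v_gen.
  by rewrite (image_comp v f).
Qed.

End Transport.

(** An indexed family expresses the count [2n] through injectivity. The empty polytope has no
    vertices, and in [[set 0]] the origin is the only one, so there the family is constant. *)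
Theorem theorem4p5 (R : realType) (n : nat) (hn : (2 <= n)%N)
    (V : vectType R) (dot : {dot V for (@idfun R)}) (Phi P : set V)
    (hPhi : type_B n dot Phi \/ type_C n dot Phi)
    (hP : alcoved_polytope dot Phi P) (P_neq0 : P !=set0)
    (hsym : weyl_symmetric dot Phi P) :
  exists v : 'I_(2 * n) -> V,
    [/\ P <> [set 0] -> injective v,
        forall i, vertex dot P (v i) &
        generating_set dot Phi P (range v)].
Proof.
have [c c0 iso] : exists2 c : R, 0 < c & root_system_iso dot (@std_BC R n c) Phi.
  case: hPhi => -[_ iso]; last by exists 2.
  exists 1 => //; suff -> : std_BC 1 = @std_B R n by [].
  congr (_ `|` _); apply/seteqP.
  by split=> v [i [s ->]]; exists i, s; rewrite scale1r.
have [v [v_inj v_vertex v_gen]] := symmetric_generators hn c0 iso hP P_neq0 hsym.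
have card2n : (2 * n)%N = #|{: 'I_n * bool}|.
  by rewrite card_prod card_ord card_bool mulnC.
pose e (i : 'I_(2 * n)) : 'I_n * bool := enum_val (cast_ord card2n i).
have e_inj : injective e by move=> i j /enum_val_inj/cast_ord_inj.
exists (v \o e); split=> [/v_inj v_i|i|]; first exact: inj_comp.
  exact: v_vertex.
suff -> : range (v \o e) = range v by [].
apply/seteqP; split=> [_ [i _ <-]|_ [q _ <-]]; first by exists (e i).
exists (cast_ord (esym card2n) (enum_rank q)) => //.
by rewrite /= /e cast_ordKV enum_rankK.
Qed.
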